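(* Let $\Lambda$ be an irreducible bilinear algorithm, given by matrices $(F^{(A)},F^{(B)},F^{(C)})$, with rank $r^{(\Lambda)}$, with $F^{(A)},F^{(B)},F^{(C)}$ having $r^{(A)},r^{(B)},r^{(C)}$ rows respectively, and let $\mathcal{E}_\Lambda$ be an expansion bound for $\Lambda$. Let $p$ be a number of processors dividing $r^{(\Lambda)},r^{(A)},r^{(B)},r^{(C)}$. Then for every storage-balanced schedule on the $p$-processor parallel machine of any execution DAG of $\Lambda$, the horizontal communication cost $W$ satisfies $$W\ge c^{(A)}+c^{(B)}+c^{(C)}$$ for some non-negative integers $c^{(A)},c^{(B)},c^{(C)}$ such that $$\frac{r^{(\Lambda)}}{p}\le \mathcal{E}_\Lambda\!\left(c^{(A)}+\frac{r^{(A)}}{p},\;c^{(B)}+\frac{r^{(B)}}{p},\;c^{(C)}+\frac{r^{(C)}}{p}\right).$$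
   Context: $\mathbb{N}$ includes $0$. Bilinear algorithm. A bilinear algorithm $\Lambda$ is a triple of real matrices $(F^{(A)},F^{(B)},F^{(C)})$ with the same number of columns. On input vectors $a,b$ it computes $c=F^{(C)}\big[((F^{(A)})^{\mathsf T}a)\odot((F^{(B)})^{\mathsf T}b)\big]$, $\odot$ being the entrywise product. Its rank is the common number of columns (the number of scalar products computed). It is irreducible if each of the three matrices has full row rank. A restriction of $\Lambda$ is a bilinear algorithm $(R^{(A)},R^{(B)},R^{(C)})$ obtained by selecting the same subset of columns from all three matrices. Expansion bound. An expansion bound for $\Lambda$ is a function $\mathcal{E}_\Lambda:\mathbb{N}^3\to\mathbb{N}$, nondecreasing in each variable, such that for every restriction $(R^{(A)},R^{(B)},R^{(C)})$ of $\Lambda$, its number of columns is at most $\mathcal{E}_\Lambda(\operatorname{rank}R^{(A)},\operatorname{rank}R^{(B)},\operatorname{rank}R^{(C)})$ (matrix ranks). Execution DAG. An execution DAG of $\Lambda$ is a directed acyclic graph $G=(V,E)$ in which each vertex has in-degree $0$ (an input value, i.e. an entry of $a$ or $b$) or in-degree $2$ (the result of a weighted addition or of a multiplication of its two predecessors). $V$ is a disjoint union $V^{(A)}\cup V^{(B)}\cup V^{(C)}$: vertices of $V^{(A)}$ (resp. $V^{(B)}$) are linear combinations of entries of $a$ (resp. $b$), vertices of $V^{(C)}$ are the computed products and linear combinations of products. $V^{(I)}\subseteq V^{(A)}\cup V^{(B)}$ is the set of inputs and $V^{(M)}\subseteq V^{(C)}$ the set of computed products, one for each column ($|V^{(M)}|$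 equals the rank). The outputs (entries of $c$) are vertices of $V^{(C)}$. Edges go within $V^{(A)}$, within $V^{(B)}$ (these compute, by additions, the linear combinations that are the operands of the products), from $V^{(A)}$ to $V^{(M)}$ and from $V^{(B)}$ to $V^{(M)}$ (each product has exactly one operand from each), and from $V^{(C)}$ to $V^{(C)}\setminus V^{(M)}$ (summations computing the outputs as the linear combinations of products prescribed by $F^{(C)}$). Parallel machine with $p$ processors. The processors have a fully connected network and exchange elements (vertex values) by point-to-point messages. A parallel schedule of an execution DAG assigns each non-input vertex to exactly one processor, which computes it (no recomputation); operands must be present on that processor, either because it initially owned them, computed them, or received them. Each input element is on exactly one processor at the start. The horizontal communication cost $W$ is the largest, over processors, total number of elements sent and received by that processor during the schedule. A schedule is storage-balanced if at the start each processor owns exactly a $1/p$ fraction of the elements of each of the two operands ($r^{(A)}/p$ entries of $a$ and $r^{(B)}/p$ entries of $b$), and at the end each processor owns exactly $r^{(C)}/p$ of the entries of the output $c$, each output entry being on a unique processor. *)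

(* Defs.v *)
From HB Require Import structures.
From mathcomp Require Import all_boot all_order all_algebra.
From mathcomp Require Import reals.
Set Implicit Arguments.
Unset Strict Implicit.
Unset Printing Implicit Defensive.
Import GRing.Theory.
Local Open Scope ring_scope.

(* On inputs [a], [b] the algorithm computes
   c = FC *m ((FA^T *m a) .* (FB^T *m b)), with .* the entrywise product;
   its rank is the common number [r] of columns. *)
Record bilinear_alg (R : realType) (rA rB rC r : nat) := BilinearAlg {
  FA : 'M[R]_(rA, r);
  FB : 'M[R]_(rB, r);
  FC : 'M[R]_(rC, r) }.

Definition irreducible_alg (R : realType) (rA rB rC r : nat)
    (L : bilinear_alg R rA rB rC r) : bool :=
  [&& row_free (FA L), row_free (FB L) & row_free (FC L)].

Definition select_cols (R : realType) (m r : nat) (S : {set 'I_r})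
    (M : 'M[R]_(m, r)) : 'M[R]_(m, #|S|) :=
  colsub (fun k : 'I_#|S| => enum_val k) M.

Definition restriction (R : realType) (rA rB rC r : nat)
    (L : bilinear_alg R rA rB rC r) (S : {set 'I_r}) :
    bilinear_alg R rA rB rC #|S| :=
  BilinearAlg (select_cols S (FA L)) (select_cols S (FB L))
              (select_cols S (FC L)).

Definition expansion_bound (R : realType) (rA rB rC r : nat)
    (L : bilinear_alg R rA rB rC r) (E : nat -> nat -> nat -> nat) : Prop :=
  [/\ forall y z, {homo (fun x => E x y z) : x x' / (x <= x')%N},
      forall x z, {homo (fun y => E x y z) : y y' / (y <= y')%N},
      forall x y, {homo (fun z => E x y z) : z z' / (z <= z')%N} &
      forall S : {set 'I_r}, let L' := restriction L S in
        (#|S| <= E (\rank (FA L')) (\rank (FB L')) (\rank (FC L')))%N].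

(* The value of a vertex is represented by its coefficients: [coefA v] over
   the entries of a for v in [VA], [coefB v] over the entries of b for v in
   [VB], and [coefC v] over the r products for v in [VC].  Outside the
   corresponding part these labels are meaningless and unconstrained.
   [edge u v] means that u is an operand of v; [weight u v] is the factor
   applied to u when v is a weighted addition (unused on products). *)
Record exec_dag (R : realType) (rA rB rC r : nat)
    (L : bilinear_alg R rA rB rC r) := ExecDag {
  vert : finType;
  edge : rel vert;
  weight : vert -> vert -> R;
  VA : {set vert};
  VB : {set vert};
  VC : {set vert};
  inA : 'I_rA -> vert;
  inB : 'I_rB -> vert;
  prodv : 'I_r -> vert;
  outv : 'I_rC -> vert;
  coefA : vert -> 'cV[R]_rA;
  coefB : vert -> 'cV[R]_rB;
  coefC : vert -> 'rV[R]_r;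
  VI := inA @: [set: 'I_rA] :|: inB @: [set: 'I_rB];
  VM := prodv @: [set: 'I_r];
  preds := fun v => [set u | edge u v];
  dag_acyclic : forall (x : vert) (s : seq vert), ~~ cycle edge (x :: s);
  dag_cover : VA :|: VB :|: VC = [set: vert];
  dag_disjoint : [/\ [disjoint VA & VB], [disjoint VA & VC]
                   & [disjoint VB & VC]];
  dag_inA : injective inA /\ (forall i, inA i \in VA);
  dag_inB : injective inB /\ (forall j, inB j \in VB);
  dag_prodv : injective prodv /\ (forall k, prodv k \in VC);
  dag_outv : forall i, outv i \in VC;
  dag_indegree : forall v, #|preds v| = (if v \in VI then 0 else 2)%N;
  dag_edges : forall u v, edge u v ->
    [|| (u \in VA) && (v \in VA),
        (u \in VB) && (v \in VB),
        (u \in VA :|: VB) && (v \in VM)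
      | (u \in VC) && (v \in VC :\: VM)];
  dag_coef_inA : forall i, coefA (inA i) = delta_mx i 0;
  dag_coef_inB : forall j, coefB (inB j) = delta_mx j 0;
  dag_coef_prodv : forall k, coefC (prodv k) = delta_mx 0 k;
  dag_addA : forall v, v \in VA :\: VI ->
    coefA v = \sum_(u in preds v) weight u v *: coefA u;
  dag_addB : forall v, v \in VB :\: VI ->
    coefB v = \sum_(u in preds v) weight u v *: coefB u;
  dag_addC : forall v, v \in VC :\: VM ->
    coefC v = \sum_(u in preds v) weight u v *: coefC u;
  dag_operands : forall k, exists uA uB : vert,
    [/\ uA \in VA, uB \in VB, preds (prodv k) = [set uA; uB],
        coefA uA = col k (FA L) & coefB uB = col k (FB L)];
  dag_output : forall i, coefC (outv i) = row i (FC L) }.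

(* [Send v q q'] moves a copy of the value of v from processor q to q'. *)
Inductive event (V : Type) (p : nat) : Type :=
| Compute of V & 'I_p
| Send of V & 'I_p & 'I_p.

Definition computes (V : eqType) (p : nat) (v : V) (e : event V p) : bool :=
  if e is Compute u _ then u == v else false.

Definition sent_by (V : Type) (p : nat) (q : 'I_p) (e : event V p) : bool :=
  if e is Send _ q1 _ then q1 == q else false.

Definition received_by (V : Type) (p : nat) (q : 'I_p) (e : event V p) : bool :=
  if e is Send _ _ q2 then q2 == q else false.

Section Execution.
Variables (R : realType) (rA rB rC r p : nat) (L : bilinear_alg R rA rB rC r).
Variable G : exec_dag L.

(* [(v, q)] belongs to the state when the value of v is known to q. *)
Definition state := {set (vert G * 'I_p)%type}.

Definition enabled (st : state) (e : event (vert G) p) : bool :=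
  match e with
  | Compute v q => [forall (u | edge u v), (u, q) \in st]
  | Send v q q' => (q != q') && ((v, q) \in st)
  end.

Definition step (st : state) (e : event (vert G) p) : state :=
  match e with
  | Compute v q => (v, q) |: st
  | Send v _ q' => (v, q') |: st
  end.

Fixpoint executable (st : state) (s : seq (event (vert G) p)) : bool :=
  if s is e :: s' then enabled st e && executable (step st e) s' else true.

Definition initial_state (ownA : 'I_rA -> 'I_p) (ownB : 'I_rB -> 'I_p) : state :=
  [set (inA G i, ownA i) | i : 'I_rA] :|: [set (inB G j, ownB j) | j : 'I_rB].

(* The events of all processors are listed in an order compatible with
   causality; [W] below does not depend on the chosen linearization. *)
Record schedule := Schedule {
  ownA : 'I_rA -> 'I_p;
  ownB : 'I_rB -> 'I_p;
  events : seq (event (vert G) p);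
  sched_executable : executable (initial_state ownA ownB) events;
  sched_compute_once : forall v : vert G,
    count (computes v) events = (v \notin VI G) }.

Definition final_state (s : schedule) : state :=
  foldl step (initial_state (ownA s) (ownB s)) (events s).

(* Values are never discarded, so several processors may know an output at
   the end; [ownC] designates the one processor that keeps it. *)
Definition storage_balanced (s : schedule) : Prop :=
  [/\ forall q : 'I_p, #|[set i | ownA s i == q]| = (rA %/ p)%N,
      forall q : 'I_p, #|[set j | ownB s j == q]| = (rB %/ p)%N &
      exists ownC : 'I_rC -> 'I_p,
        (forall i, (outv G i, ownC i) \in final_state s) /\
        (forall q : 'I_p, #|[set i | ownC i == q]| = (rC %/ p)%N)].

Definition horizontal_cost (s : schedule) : nat :=
  \max_(q < p) (count (sent_by q) (events s) + count (received_by q) (events s))%N.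

End Execution.

(* Main.v *)
(** Some processor q computes a set S of at least r/p products.  The operands of
    these products are spanned by the inputs q owns and those it receives,
    which bounds the ranks of the columns S of FA and FB.  Dually, restrict the
    coefficients of every value to the products in S: the products computed
    away from q restrict to 0, so all that the other processors ever know of S
    is spanned by what q sent; together with the outputs kept by q this bounds
    the rank of the columns S of FC. *)
Require Import Defs.
From mathcomp Require Import all_boot all_order all_algebra.
From mathcomp Require Import reals.
Set Implicit Arguments.
Unset Strict Implicit.
Unset Printing Implicit Defensive.
Import GRing.Theory.

(** * Spans of finite families and a pigeonhole bound *)

Lemma span_family (F : fieldType) (I : finType) (n : nat) (T : {set I})
    (g : I -> 'rV[F]_n) :
  exists2 U : 'M[F]_n, \rank U <= #|T| & forall i, i \in T -> (g i <= U)%MS.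
Proof.
exists (\sum_(i in T) <<g i>>)%MS.
  rewrite -sum1_card; apply: leq_trans (mxrank_sum_leqif _) _ => /=.
  by apply: leq_sum => i _; rewrite mxrank_gen rank_leq_row.
by move=> i iT; rewrite (sumsmx_sup i) // genmxE.
Qed.

Lemma pigeonhole_cover (I J : finType) (T : J -> {set I}) (m : nat) :
  0 < #|J| -> #|J| * m <= #|I| -> (forall i, exists j, i \in T j) ->
  exists j, m <= #|T j|.
Proof.
move=> /card_gt0P [j0 _] leI cov; apply/existsP; apply: contraLR leI.
rewrite negb_exists => /forallP small; rewrite -ltnNge.
have covT : [set: I] \subset \bigcup_j T j.
  apply/subsetP => i _; have [j iT] := cov i.
  by apply/bigcupP; exists j.
apply: (@leq_ltn_trans (\sum_j #|T j|)).
  rewrite -cardsT; apply: leq_trans (subset_leq_card covT) _.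
  elim/big_rec2: _ => [|j n A _ leA]; first by rewrite cards0.
  by apply: leq_trans (leq_card_setU _ _) _; rewrite leq_add2l.
(* Strictness comes from the single term [j0]; the other terms are compared weakly. *)
rewrite -sum_nat_const (bigD1 j0) //= [ltnRHS](bigD1 j0) //= -addSn leq_add //.
  by rewrite ltnNge small.
by apply: leq_sum => j _; rewrite ltnW // ltnNge small.
Qed.

(** * Counting the events of a schedule *)

Definition computed_in (V : eqType) (p : nat) (v : V) (D : pred 'I_p)
    (e : event V p) : bool :=
  if e is Compute u q then (u == v) && D q else false.

(** [D] will be [q] alone for the operands and all processors but [q] for the products, so one
    notion of crossing message covers both receipts by [q] and sends from [q]. *)
Definition enters (V : finType) (p : nat) (X : {set V}) (D : pred 'I_p)
    (e : event V p) : bool :=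
  if e is Send v q q' then [&& v \in X, ~~ D q & D q'] else false.

Lemma count_computed_in (V : eqType) (p : nat) (v : V) (D : pred 'I_p)
    (s : seq (event V p)) :
  count (computed_in v D) s + count (computed_in v (predC D)) s
  = count (computes v) s.
Proof.
elim: s => //= e s <-; rewrite addnACA; congr (_ + _).
by case: e => [u q|u q q'] //=; case: (u == v); case: (D q).
Qed.

Lemma has_computes (V : eqType) (p : nat) (v : V) (s : seq (event V p)) :
  has (computes v) s -> exists q : 'I_p, has (computed_in v (pred1 q)) s.
Proof.
elim: s => //= e s IH /orP[|/IH [q Hq]]; last by exists q; rewrite Hq orbT.
by case: e => //= u q uv; exists q; rewrite uv eqxx.
Qed.

Lemma has_computed_in (V : eqType) (p : nat) (v : V) (D : pred 'I_p)
    (s : seq (event V p)) :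
  has (computed_in v D) s -> has (computes v) s.
Proof. by apply: sub_has => -[u q|] //= /andP[]. Qed.

(** A message carries one value, which lies in at most one of [X] and [Y], so no receipt is counted
    twice. *)
Lemma count_enters_received (V : finType) (p : nat) (X Y : {set V}) (q : 'I_p)
    (s : seq (event V p)) :
  [disjoint X & Y] ->
  count (enters X (pred1 q)) s + count (enters Y (pred1 q)) s
  <= count (received_by q) s.
Proof.
move=> dXY; elim: s => //= e s IH; rewrite addnACA leq_add //.
case: e => //= v q1 q2; have := disjointFr dXY (x := v).
by case: (v \in X) => [->|_] //; case: (v \in Y); case: (q1 == q); case: (q2 == q).
Qed.

Lemma count_enters_sent (V : finType) (p : nat) (X : {set V}) (q : 'I_p)
    (s : seq (event V p)) :
  count (enters X (predC1 q)) s <= count (sent_by q) s.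
Proof. by apply: sub_count => -[|v q1 q2] //= /and3P[_ /negPn]. Qed.

(** * Spans of the values known to a set of processors *)

Section Execution.
Variables (R : realType) (rA rB rC r p : nat) (L : bilinear_alg R rA rB rC r).
Variable G : exec_dag L.
Implicit Types (st : state p G) (s : seq (event (vert G) p)).

Lemma subset_step st (e : event (vert G) p) : st \subset step st e.
Proof. by case: e => * /=; apply: subsetUr. Qed.

Lemma subset_run s st : st \subset foldl (@step _ _ _ _ _ p _ G) st s.
Proof.
elim: s st => //= e s IH st.
exact: subset_trans (subset_step st e) (IH _).
Qed.

(** Operands are present when the computation takes place, and knowledge is never lost
    afterwards. *)
Lemma computed_operands s st v q u :
  executable st s -> has (computed_in v (pred1 q)) s -> edge u v ->
  (u, q) \in foldl (@step _ _ _ _ _ p _ G) st s.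
Proof.
move=> + + uv; elim: s st => //= e s IH st /andP[en ex] /orP[|hs]; last exact: IH.
case: e en ex => //= v' q' /forall_inP en ex /andP[/eqP ? /eqP ?]; subst v' q'.
apply: (subsetP (subset_run _ _)).
by rewrite inE en ?orbT.
Qed.

(* Only values entering D from outside enlarge the span of what D knows. *)
Lemma known_span (n : nat) (X : {set vert G}) (D : pred 'I_p)
    (f : vert G -> 'rV[R]_n) s st (U0 : 'M[R]_n) :
  executable st s ->
  (forall v q, v \in X -> D q -> (v, q) \in st -> (f v <= U0)%MS) ->
  (forall v, v \in X -> has (computed_in v D) s ->
    (f v <= U0)%MS \/
    preds v \subset X /\
    exists w : vert G -> R, f v = (\sum_(u in preds v) w u *: f u)%R) ->
  exists2 U : 'M[R]_n, \rank U <= \rank U0 + count (enters X D) s &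
    forall v q, v \in X -> D q ->
      (v, q) \in foldl (@step _ _ _ _ _ p _ G) st s -> (f v <= U)%MS.
Proof.
elim: s st U0 => [|e s IH] st U0 /=; first by exists U0; rewrite ?addn0.
move=> /andP[en ex] init comp.
(* The head event is absorbed into the starting span of the induction: [U1] gains at most one
   dimension, and only for a message that enters [D]. *)
pose U1 := if e is Send v q q' then
             if enters X D e then (U0 + <<f v>>)%MS else U0 else U0.
have sub1 : (U0 <= U1)%MS.
  rewrite /U1; case: e {en ex comp U1} => // v q q'.
  by case: ifP => // _; apply: addsmxSl.
have rk1 : \rank U1 <= \rank U0 + enters X D e.
  rewrite /U1; case: e {en ex comp U1 sub1} => [v q|v q q']; first exact: leq_addr.
  case: ifP => _; last exact: leq_addr.
  apply: leq_trans (mxrank_adds_leqif _ _) _ => /=.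
  by rewrite leq_add2l mxrank_gen rank_leq_row.
have init1 v q : v \in X -> D q -> (v, q) \in step st e -> (f v <= U1)%MS.
  move=> vX Dq; case: e en ex comp @U1 sub1 rk1 => [u q1|u q1 q2] /=.
    move=> /forall_inP en _ comp _ _; rewrite !inE.
    case/orP=> [/eqP[? ?]|]; last exact: init.
    subst u q1; have := comp v vX; rewrite eqxx Dq => /(_ isT).
    case=> // -[sX [w ->]]; apply: summx_sub => u uv; apply: scalemx_sub.
    apply: (init u q) => //; first exact: (subsetP sX).
    by apply: en; rewrite inE in uv.
  move=> /andP[_ kn] _ _ sub1 _; rewrite !inE.
  case/orP=> [/eqP[? ?]|vst]; last exact: submx_trans (init v q vX Dq vst) sub1.
  (* A sender inside [D] already had [f v] in the span; otherwise [<<f v>>] has just been added. *)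
  subst u q2; rewrite vX Dq andbT /=; case: (boolP (D q1)) => Dq1 /=.
    exact: (init v q1).
  by rewrite (submx_trans _ (addsmxSr _ _)) // genmxE.
have [v vX hv|U rkU HU] := IH _ U1 ex init1.
  have [|le0|] := comp v vX; first by rewrite hv orbT.
    by left; apply: submx_trans sub1.
  by right.
exists U => //; apply: leq_trans rkU _.
by rewrite addnA leq_add2r.
Qed.

(** Common to both operands: [known_span] with [D] reduced to [q], starting from the span of the
    unit vectors of the inputs owned by [q]. The final span contains the columns of [F] indexed by
    [S]. Coefficients are transposed because subspaces are row spaces. *)
Lemma operand_rank (m : nat) (X : {set vert G}) (f : vert G -> 'cV[R]_m)
    (own : 'I_m -> 'I_p) (F : 'M[R]_(m, r)) (S : {set 'I_r}) (q : 'I_p) s st :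
  executable st s ->
  (forall v, v \in X -> (v, q) \in st ->
    exists2 i, own i = q & f v = delta_mx i 0%R) ->
  (forall v, v \in X -> has (computed_in v (pred1 q)) s ->
    preds v \subset X /\
    exists w : vert G -> R, f v = (\sum_(u in preds v) w u *: f u)%R) ->
  (forall k, k \in S -> exists u, [/\ u \in X,
    (u, q) \in foldl (@step _ _ _ _ _ p _ G) st s & f u = col k F]) ->
  \rank (select_cols S F)
  <= count (enters X (pred1 q)) s + #|[set i | own i == q]|.
Proof.
move=> ex init comp opd.
have [U0 rk0 H0] := span_family [set i | own i == q]
                      (fun i => delta_mx 0%R i : 'rV[R]_m).
have [||U rkU HU] := @known_span _ X (pred1 q) (fun v => (f v)^T)%R s st U0 ex.
- move=> v q' vX /eqP -> /(init v vX)[i iq ->].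
  by rewrite trmx_delta H0 // inE iq.
- move=> v vX /(comp v vX)[sX [w ->]]; right; split=> //; exists w.
  by rewrite linear_sum; apply: eq_bigr => u _; rewrite linearZ.
rewrite -mxrank_tr; apply: (@leq_trans (\rank U)).
  apply: mxrankS; apply/row_subP => k.
  have [u [uX uq fu]] := opd _ (enum_valP k).
  suff -> : row k (select_cols S F)^T = ((f u)^T)%R by apply: (HU u q); rewrite /=.
  by rewrite fu; apply/rowP => i; rewrite !mxE.
by rewrite addnC; apply: leq_trans rkU _; rewrite leq_add2r.
Qed.

End Execution.

(** Disjointness of the three parts leaves only one possible kind of edge into such a vertex, so the
    sums of the DAG stay within one system of coordinates, as [known_span] requires. *)
Lemma preds_sub (R : realType) (rA rB rC r : nat) (L : bilinear_alg R rA rB rC r)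
    (G : exec_dag L) (v : vert G) :
  [/\ v \in VA G -> preds v \subset VA G,
      v \in VB G -> preds v \subset VB G &
      v \in VC G :\: VM G -> preds v \subset VC G].
Proof.
have [dAB dAC dBC] := dag_disjoint G; have [_ pC] := dag_prodv G.
have MC w : w \in VM G -> w \in VC G by case/imsetP => k _ ->.
split=> [vA|vB|/setDP[vC vM]]; apply/subsetP => u; rewrite inE => /dag_edges.
- have vB := disjointFr dAB vA; have vC := disjointFr dAC vA.
  case/or4P=> /andP[] //; first by rewrite vB.
    by move=> _ /MC; rewrite vC.
  by move=> _ /setDP[]; rewrite vC.
- have vA := disjointFl dAB vB; have vC := disjointFr dBC vB.
  case/or4P=> /andP[] //; first by rewrite vA.
    by move=> _ /MC; rewrite vC.
  by move=> _ /setDP[]; rewrite vC.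
- case/or4P=> /andP[] //; first by rewrite (disjointFl dAC vC).
    by rewrite (disjointFl dBC vC).
  by rewrite (negPf vM).
Qed.

(** * Ranks of the columns computed by one processor *)

Section Schedule.
Variables (R : realType) (rA rB rC r p : nat) (L : bilinear_alg R rA rB rC r).
Variables (G : exec_dag L) (s : schedule p G).

Definition products_on (q : 'I_p) : {set 'I_r} :=
  [set k | has (computed_in (prodv G k) (pred1 q)) (events s)].

Lemma computed_notin_VI (v : vert G) (D : pred 'I_p) :
  has (computed_in v D) (events s) -> v \notin VI G.
Proof.
move/has_computed_in; rewrite has_count sched_compute_once.
by case: (v \notin VI G).
Qed.

Lemma products_on_cover (k : 'I_r) : exists q, k \in products_on q.
Proof.
have [dAB dAC dBC] := dag_disjoint G; have [_ pC] := dag_prodv G.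
have [_ iA] := dag_inA G; have [_ iB] := dag_inB G.
have [|q Hq] := @has_computes _ p (prodv G k) (events s).
  rewrite has_count sched_compute_once lt0b inE negb_or.
  apply/andP; split; apply/imsetP => -[i _ e].
    by have := disjointFr dAC (iA i); rewrite -e pC.
  by have := disjointFr dBC (iB i); rewrite -e pC.
by exists q; rewrite inE.
Qed.

(** Without recomputation, the computations on [q] and away from [q] number at most one in total. *)
Lemma products_on_unique (q : 'I_p) (k : 'I_r) :
  has (computed_in (prodv G k) (predC1 q)) (events s) -> k \notin products_on q.
Proof.
rewrite /products_on [in _ \in _]inE !has_count -leqNgt => ne_q.
rewrite -(leq_add2r (count (computed_in (prodv G k) (predC1 q)) (events s))).
rewrite [leqLHS]count_computed_in sched_compute_once add0n.
by apply: leq_trans ne_q; apply: leq_b1.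
Qed.

Lemma rank_FA_products_on (q : 'I_p) :
  \rank (select_cols (products_on q) (FA L))
  <= count (enters (VA G) (pred1 q)) (events s) + #|[set i | ownA s i == q]|.
Proof.
have [dAB _ _] := dag_disjoint G; have [_ iB] := dag_inB G.
apply: operand_rank (sched_executable s) _ _ _.
- move=> v vA; case/setUP=> /imsetP[i _ [ev eq]]; subst v.
    by exists i => //; exact: dag_coef_inA.
  by have := disjointFr dAB vA; rewrite iB.
- move=> v vA /computed_notin_VI vI; have [sA _ _] := preds_sub v.
  split; first exact: sA.
  by exists (fun u => weight u v); apply: dag_addA; rewrite inE vI.
- move=> k; rewrite inE => hk.
  have [uA [uB [uAA _ pk cA _]]] := dag_operands G k.
  exists uA; split=> //; apply: computed_operands (sched_executable s) hk _.
  by have := set21 uA uB; rewrite -pk inE.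
Qed.

Lemma rank_FB_products_on (q : 'I_p) :
  \rank (select_cols (products_on q) (FB L))
  <= count (enters (VB G) (pred1 q)) (events s) + #|[set j | ownB s j == q]|.
Proof.
have [dAB _ _] := dag_disjoint G; have [_ iA] := dag_inA G.
apply: operand_rank (sched_executable s) _ _ _.
- move=> v vB; case/setUP=> /imsetP[i _ [ev eq]]; subst v.
    by have := disjointFl dAB vB; rewrite iA.
  by exists i => //; exact: dag_coef_inB.
- move=> v vB /computed_notin_VI vI; have [_ sB _] := preds_sub v.
  split; first exact: sB.
  by exists (fun u => weight u v); apply: dag_addB; rewrite inE vI.
- move=> k; rewrite inE => hk.
  have [uA [uB [_ uBB pk _ cB]]] := dag_operands G k.
  exists uB; split=> //; apply: computed_operands (sched_executable s) hk _.
  by have := set22 uA uB; rewrite -pk inE.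
Qed.

Lemma rank_FC_products_on (ownC : 'I_rC -> 'I_p) (q : 'I_p) :
  (forall i, (outv G i, ownC i) \in final_state s) ->
  \rank (select_cols (products_on q) (FC L))
  <= count (enters (VC G) (predC1 q)) (events s) + #|[set i | ownC i == q]|.
Proof.
move=> fin; set S := products_on q.
have [_ dAC dBC] := dag_disjoint G.
have [_ iA] := dag_inA G; have [_ iB] := dag_inB G.
pose f (v : vert G) := select_cols S (Defs.coefC v).
(* The starting span is zero: only inputs are known at first, and none of them lies in [VC]. *)
have [||U rkU HU] := @known_span _ _ _ _ _ p L G _ (VC G) (predC1 q) f _ _ 0%R
                       (sched_executable s).
- move=> v q' vC _; case/setUP=> /imsetP[i _ [ev eq]]; subst v.
    by have := disjointFr dAC (iA i); rewrite vC.
  by have := disjointFr dBC (iB i); rewrite vC.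
- move=> v vC hv; case: (boolP (v \in VM G)) => [/imsetP[k _ ek]|vM].
    left; subst v; have kS := products_on_unique hv.
    (* The unit vector of a product outside [S] vanishes on the columns in [S]. *)
    rewrite submx0; apply/eqP/rowP => j; rewrite !mxE dag_coef_prodv !mxE /=.
    by case: eqP => // ej; rewrite -ej enum_valP in kS.
  right; have vCM : v \in VC G :\: VM G by rewrite inE vM.
  have [_ _ sC] := preds_sub v; split; first exact: sC.
  exists (fun u => weight u v); rewrite /f (dag_addC vCM) /select_cols.
  apply/rowP => j; rewrite !mxE !summxE; apply: eq_bigr => u _.
  by rewrite !mxE.
(* Outputs kept by [q] may be unknown elsewhere, so their rows are spanned separately. *)
have [Uq rkq Hq] := span_family [set i | ownC i == q] (fun i => f (outv G i)).
have fE i : row i (select_cols S (FC L)) = f (outv G i).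
  by rewrite /f dag_output; apply/rowP => j; rewrite !mxE.
apply: (@leq_trans (\rank (U + Uq)%MS)).
  apply: mxrankS; apply/row_subP => i; rewrite fE.
  case: (eqVneq (ownC i) q) => oi.
    by apply: submx_trans (addsmxSr _ _); apply: Hq; rewrite inE oi.
  apply: submx_trans (addsmxSl _ _).
  by apply: (HU _ (ownC i)) => //; exact: dag_outv.
apply: leq_trans (mxrank_adds_leqif _ _) _ => /=; apply: leq_add => //.
by rewrite mxrank0 in rkU.
Qed.

End Schedule.

Theorem theorem5p4 (R : realType) (rA rB rC r p : nat)
    (L : bilinear_alg R rA rB rC r) (E : nat -> nat -> nat -> nat)
    (Lirr : irreducible_alg L) (LE : expansion_bound L E)
    (p_gt0 : 0 < p)
    (p_dvd_r : p %| r) (p_dvd_rA : p %| rA) (p_dvd_rB : p %| rB)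
    (p_dvd_rC : p %| rC)
    (G : exec_dag L) (s : schedule p G) (s_bal : storage_balanced s) :
  exists cA cB cC : nat,
    cA + cB + cC <= horizontal_cost s /\
    r %/ p <= E (cA + rA %/ p) (cB + rB %/ p) (cC + rC %/ p).
Proof.
have [balA balB [ownC [fin balC]]] := s_bal.
have [||q leS] := pigeonhole_cover (m := r %/ p) _ _ (products_on_cover s).
- by rewrite card_ord.
- by rewrite !card_ord mulnC leq_divM.
(* The witnesses count the values of [VA] and of [VB] that [q] receives and the values of [VC] that
   it sends; together they are at most the traffic of [q]. *)
exists (count (enters (VA G) (pred1 q)) (events s)),
       (count (enters (VB G) (pred1 q)) (events s)),
       (count (enters (VC G) (predC1 q)) (events s)); split.
  apply: leq_trans (leq_bigmax q).
  rewrite addnC; apply: leq_add; first exact: count_enters_sent.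
  by apply: count_enters_received; have [] := dag_disjoint G.
have [monoA monoB monoC bound] := LE.
apply: leq_trans leS _; apply: leq_trans (bound _) _ => /=.
have rkA := rank_FA_products_on s q; rewrite balA in rkA.
have rkB := rank_FB_products_on s q; rewrite balB in rkB.
have rkC := rank_FC_products_on q fin; rewrite balC in rkC.
apply: leq_trans (monoA _ _ _ _ rkA) _.
by apply: leq_trans (monoB _ _ _ _ rkB) _; apply: monoC.
Qed.
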